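(* Let $R$ be a commutative ring with identity, let $n\geq 2$ be an integer, and let $A$ be an $n\times n$ matrix over $R$. Then the formula $$ABA=\mathrm{Tr}(AB)\,A=A\,\mathrm{Tr}(BA)$$ holds for every $n\times n$ matrix $B$ over $R$ if and only if all $2\times 2$ minors of $A$ equal zero.
   Context: $\mathrm{Tr}$ denotes the trace of a square matrix. For a scalar $c\in R$ and a matrix $A$, both $cA$ and $Ac$ denote the matrix obtained by multiplying every entry of $A$ by $c$. A $2\times 2$ minor of $A=[a_{ij}]$ is the determinant $a_{ik}a_{jl}-a_{il}a_{jk}$ of a $2\times 2$ submatrix with row indices $i<j$ and column indices $k<l$. *)

(* Defs.v *)
From mathcomp Require Import all_boot all_order all_algebra.

Set Implicit Arguments.
Unset Strict Implicit.
Unset Printing Implicit Defensive.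

Import GRing.Theory.
Local Open Scope ring_scope.

Definition pair_ord (n : nat) (i j : 'I_n) (a : 'I_2) : 'I_n :=
  if a == ord0 then i else j.

(* Rings are [comPzRingType] throughout, so that the zero ring is allowed. *)
Definition minor2 (R : comPzRingType) (n : nat) (A : 'M[R]_n)
    (i j k l : 'I_n) : R :=
  \det (mxsub (pair_ord i j) (pair_ord k l) A).

Lemma minor2E (R : comPzRingType) (n : nat) (A : 'M[R]_n) (i j k l : 'I_n) :
  minor2 A i j k l = A i k * A j l - A i l * A j k.
Proof.
rewrite /minor2 (expand_det_row _ ord0) !big_ord_recl big_ord0 addr0.
rewrite /cofactor !det_mx11 !mxE /pair_ord /=.
by rewrite expr0 expr1 mul1r mulN1r mulrN.
Qed.

(* Main.v *)
Require Import Defs.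
From mathcomp Require Import all_boot all_order all_algebra.

Import GRing.Theory.
Local Open Scope ring_scope.

(** Each entry of [A *m B *m A - \tr (A *m B) *: A] is a linear form in the
    entries of [B] whose coefficients are 2 x 2 minors of [A]
    ([sandwich_sub_traceE]).  If the minors vanish, so does the difference.
    Conversely, if the difference vanishes for every [B], taking for [B] the
    matrix units isolates each coefficient, so every minor is zero.  The second
    equality of the formula is the symmetry of the trace, [mxtrace_mulC].

    The linear form involves minors with arbitrary row and column indices, while
    the theorem speaks only of increasing ones.  The minor is alternating in its
    rows and in its columns, so this makes no difference
    ([minor2_eq0_of_increasing]). *)

Lemma minor2_rowC {R : comPzRingType} {n : nat} (A : 'M[R]_n)
    (i j k l : 'I_n) :
  minor2 A j i k l = - minor2 A i j k l.
Proof. by rewrite !minor2E opprB [A j k * _]mulrC [A j l * _]mulrC. Qed.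

Lemma minor2_colC {R : comPzRingType} {n : nat} (A : 'M[R]_n)
    (i j k l : 'I_n) :
  minor2 A i j l k = - minor2 A i j k l.
Proof. by rewrite !minor2E opprB. Qed.

Lemma minor2_row_diag {R : comPzRingType} {n : nat} (A : 'M[R]_n)
    (i k l : 'I_n) :
  minor2 A i i k l = 0.
Proof. by rewrite minor2E [A i k * _]mulrC subrr. Qed.

Lemma minor2_col_diag {R : comPzRingType} {n : nat} (A : 'M[R]_n)
    (i j k : 'I_n) :
  minor2 A i j k k = 0.
Proof. by rewrite minor2E subrr. Qed.

Lemma minor2_eq0_of_increasing {R : comPzRingType} {n : nat} (A : 'M[R]_n) :
  (forall i j k l : 'I_n, (i < j)%N -> (k < l)%N -> minor2 A i j k l = 0) ->
  forall i j k l : 'I_n, minor2 A i j k l = 0.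
Proof.
move=> A0.
have A0row (i j k l : 'I_n) : (i < j)%N -> minor2 A i j k l = 0.
  move=> ij; case: (ltngtP k l) => [kl|lk|/val_inj ->]; first exact: A0.
  - by rewrite minor2_colC A0 ?oppr0.
  - exact: minor2_col_diag.
move=> i j k l; case: (ltngtP i j) => [ij|ji|/val_inj ->]; first exact: A0row.
- by rewrite minor2_rowC A0row ?oppr0.
- exact: minor2_row_diag.
Qed.

(** The entry [B k l] occurs with coefficient [A p k * A l q] in
    [(A *m B *m A) p q] and with coefficient [A l k * A p q] in
    [\tr (A *m B) * A p q]; the difference of the two is the minor on rows
    [p], [l] and columns [k], [q]. *)
Lemma sandwich_sub_traceE {R : comPzRingType} {n : nat} (A B : 'M[R]_n)
    (p q : 'I_n) :
  (A *m B *m A - \tr (A *m B) *: A) p q =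
  \sum_l \sum_k minor2 A p l k q * B k l.
Proof.
rewrite !mxE /mxtrace mulr_suml -sumrB; apply: eq_bigr => l _.
rewrite !mxE !mulr_suml -sumrB; apply: eq_bigr => k _.
by rewrite minor2E mulrBl mulrAC [A p q * _]mulrC [A l k * _ * _]mulrAC.
Qed.

Theorem theorem1 (R : comPzRingType) (n : nat) (hn : (2 <= n)%N) (A : 'M[R]_n) :
  (forall B : 'M[R]_n,
      A *m B *m A = \tr (A *m B) *: A /\
      \tr (A *m B) *: A = \tr (B *m A) *: A) <->
  (forall i j k l : 'I_n, (i < j)%N -> (k < l)%N -> minor2 A i j k l = 0).
Proof.
split=> [ABA i j k l _ _ | A0 B].
  (* In [sandwich_sub_traceE] the entry [B k j] is the one multiplied by the
     minor on rows [i], [j] and columns [k], [l], once the output entry is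
     [(i, l)]. *)
  have := sandwich_sub_traceE A (delta_mx k j) i l.
  rewrite (ABA (delta_mx k j)).1 subrr mxE (bigD1 j) //= (bigD1 k) //=.
  rewrite !mxE !eqxx mulr1 big1 => [|k' /negPf k'k]; last first.
    by rewrite mxE k'k mulr0.
  rewrite big1 => [|j' /negPf j'j]; first by rewrite !addr0.
  by apply: big1 => k' _; rewrite mxE j'j andbF mulr0.
split; last by rewrite mxtrace_mulC.
apply/eqP; rewrite -subr_eq0; apply/eqP/matrixP => p q.
rewrite sandwich_sub_traceE mxE; apply: big1 => l _; apply: big1 => k _.
by rewrite minor2_eq0_of_increasing // mul0r.
Qed.
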